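(* Let $M$ be an $N$-function and let $\phi:(0,1)\times(0,\infty)\to(0,\infty)$, $(\lambda,u)\mapsto\phi(\lambda,u)$, be a positive function that is nondecreasing in the first argument and nondecreasing in the second argument, such that $$M(\lambda u)\ \ge\ \phi(\lambda,u)\, M(u)\qquad\text{for all } 0<\lambda<1 \text{ and all } u>0.$$ Then for every $x\in L_M$ with $0\ne\|x\|\le 1$ and every $h$ with $0<h<\dfrac{1}{\|\mathbf{1}\|}$, $$\mathcal{M}(x)\ \ge\ \phi\big((1-h\|\mathbf{1}\|)\,\|x\|,\ h\big),$$ where $\mathbf{1}$ is the function on $\Omega$ identically equal to $1$.
   Context: $(\Omega,\mathfrak{A},\mu)$ is a set with a $\sigma$-algebra and a $\sigma$-additive measure $\mu$ that is finite ($\mu(\Omega)<\infty$) and continuous (every set of positive measure can be divided into two sets of equal measure). An $N$-function is a convex function $M:[0,\infty)\to[0,\infty)$ with $\lim_{u\to0}M(u)/u=0$ and $\lim_{u\to\infty}M(u)/u=\infty$. The modular generated by $M$ is $\mathcal{M}(x)=\int_\Omega M(|x(\omega)|)\,d\mu(\omega)\in[0,\infty]$ for measurable $x$ on $\Omega$. The Orlicz space $L_M$ is the set of measurable functions $x$ for which $\mathcal{M}(x/\lambda)<\infty$ for some $\lambda>0$. The norm $\|\cdot\|$ is the Luxemburg norm $\|x\|=\inf\{\lambda>0:\ \mathcal{M}(x/\lambda)\le 1\}$. *)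

(* Defs.v *)
From HB Require Import structures.
From mathcomp Require Import all_boot all_order all_algebra.
From mathcomp Require Import all_classical all_reals all_analysis.

Set Implicit Arguments.
Unset Strict Implicit.
Unset Printing Implicit Defensive.

Import Order.TTheory GRing.Theory Num.Theory.
Import numFieldNormedType.Exports.

Local Open Scope classical_set_scope.
Local Open Scope ring_scope.

Section orlicz.
Context {R : realType}.

(* Functions [0, oo[ -> [0, oo[ are total functions R -> R whose values at
   negative arguments are irrelevant.  The limit at 0 is one-sided and ignores
   the value at 0, so that M 0 = 0 is not required. *)
Record N_function (M : R -> R) : Prop := {
  N_function_ge0 : forall u, 0 <= u -> 0 <= M u ;
  N_function_convex : convex_function (`[0, +oo[%classic : set R^o) M ;
  N_function_cvg0 : M u / u @[u --> 0^'+] --> (0 : R) ;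
  N_function_cvgy : M u / u @[u --> +oo] --> +oo }.

Context {d : measure_display} {T : measurableType d}.
Variable mu : {measure set T -> \bar R}.

Definition continuous_measure :=
  forall A, measurable A -> (0 < mu A)%E ->
    exists B C, [/\ measurable B, measurable C, A = B `|` C, B `&` C = set0 &
                    mu B = mu C].

Variable M : R -> R.

Definition modular (x : T -> R) : \bar R :=
  (\int[mu]_w (M `|x w|)%:E)%E.

Definition orlicz_space : set (T -> R) :=
  [set x : T -> R | measurable_fun setT x /\
           exists2 l : R, 0 < l & (modular (fun w => (x w / l)%R) < +oo)%E].

(* inf of an empty or unbounded set of reals is 0 by convention.  The set below
   is bounded below by 0, and for x in the Orlicz space of a finite measure it
   is nonempty as soon as M 0 = 0. *)
Definition luxemburg_norm (x : T -> R) : R :=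
  inf [set l : R | 0 < l /\ (modular (fun w => (x w / l)%R) <= 1)%E].

End orlicz.

(* Main.v *)
Require Import Defs.
From HB Require Import structures.
From mathcomp Require Import all_boot all_order all_algebra.
From mathcomp Require Import all_classical all_reals all_analysis.
From mathcomp Require Import measurable_realfun ring lra.

Set Implicit Arguments.
Unset Strict Implicit.
Unset Printing Implicit Defensive.

Import Order.TTheory GRing.Theory Num.Theory.
Import numFieldNormedType.Exports.

Local Open Scope classical_set_scope.
Local Open Scope ring_scope.

(** Write N for the norm of x, a for the norm of 1, c = 1 - h a, p = c N and
f = phi p h.  Suppose first that M 0 = 0.  For l < N the modular of x / l
exceeds 1, and f M(|x| / l) is controlled pointwise in two ways.  Where
|x| >= h N, one has |x| / p >= h, so monotonicity of phi in its second argument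
and the multiplier inequality at |x| / p give f M(|x| / p) <= M(|x|);
convexity passes from p to l and gains the factor p / l.  Where |x| < h N,
convexity gives M(|x| / l) <= (h N b / l) M(1 / b) for any b slightly above a,
and M(1 / b) times the total mass is at most 1.  Both cases fit in the single
inequality [reset0_tradeoff], which [integral_tradeoff] integrates:
  l f modular(x / l) <= p modular(x) + f h N b.
Using modular(x / l) > 1 and letting l tend to N and b to a yields
f <= c modular(x) + f h a, that is, f <= modular(x).

The axioms of an N-function leave M 0 free: M may jump down immediately to the
right of the origin.  The zero set of x then adds the same constant
k = M 0 * mu {x = 0} to the modular of every multiple x / l.  So the argument is
run with M reset to 0 at the origin, whose modular J satisfies J(x / l) > 1 - k;
in the limit it gives f (1 - k) <= c J + f h a, i.e. f (c - k) <= c J.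
Since f <= p <= c by convexity ([lower_multiplier_le]), f k <= c k, and
f <= J + k follows again. *)

(** * Convexity near the origin *)

(** The values on the negative half-line are also set to 0, so that the result
is monotone, hence Borel, on the whole line. *)
Definition reset0 (R : realType) (M : R -> R) (u : R) : R :=
  if 0 < u then M u else 0.

Section N_function_theory.
Context {R : realType} (M : R -> R) (MN : N_function M).

Lemma N_function_jensen t u v : 0 <= t -> t <= 1 -> 0 <= u -> 0 <= v ->
  M (t * u + (1 - t) * v) <= t * M u + (1 - t) * M v.
Proof.
move=> t0 t1 u0 v0.
have inD (z : R) : 0 <= z -> z \in (`[0, +oo[%classic : set R^o).
  by move=> z0; rewrite inE /= in_itv/= z0.
have := N_function_convex MN (Itv01 t0 t1) (inD _ u0) (inD _ v0).
by rewrite !convRE.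
Qed.

(** When M 0 = 0 this is convexity between 0 and u.  In general 0 is replaced by
a small s > 0, where M s <= s because M s / s tends to 0. *)
Lemma N_function_le_scale t u : 0 < t -> t <= 1 -> 0 < u ->
  M (t * u) <= t * M u.
Proof.
move=> t0 t1 u0; apply/ler_addgt0Pr => e e0.
have M1 : \forall s \near (0 : R)^'+, M s / s < 1.
  exact: (cvgr_lt _ (N_function_cvg0 MN) _ ltr01).
near ((0 : R)^'+) => s.
have s0 : 0 < s by [].
have stu : s < t * u by near: s; apply: nbhs_right_lt; exact: mulr_gt0.
have se : s < e by near: s; exact: nbhs_right_lt.
have Ms : M s <= s.
  have : M s / s < 1 by near: s.
  by rewrite ltr_pdivrMr// mul1r => /ltW.
have tuu : t * u <= u by rewrite ler_piMl// ltW.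
have us0 : 0 < u - s by rewrite subr_gt0 (lt_le_trans stu).
(* p is the weight of u in the expression of t * u as a mean of s and u. *)
set p := (t * u - s) / (u - s).
have p0 : 0 <= p by rewrite divr_ge0// ltW// subr_gt0.
have pt : p <= t.
  by rewrite ler_pdivrMr// mulrBr lerD2l lerN2 ler_piMl// ltW.
have -> : t * u = p * u + (1 - p) * s by rewrite /p; field; rewrite gt_eqF.
apply: (le_trans (N_function_jensen p0 (le_trans pt t1) (ltW u0) (ltW s0))).
have Mu0 := N_function_ge0 MN (ltW u0).
have Ms0 := N_function_ge0 MN (ltW s0).
apply: lerD; first exact: ler_wpM2r.
apply: le_trans (ltW se); apply: le_trans Ms.
by rewrite ler_piMl// gerBl.
Unshelve. all: by end_near. Qed.

Lemma reset0_ge0 u : 0 <= reset0 M u.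
Proof. by rewrite /reset0; case: ifPn => // /ltW/(N_function_ge0 MN). Qed.

Lemma reset0_le_scale t u : 0 <= t -> t <= 1 ->
  reset0 M (t * u) <= t * reset0 M u.
Proof.
rewrite le_eqVlt => /predU1P[<- _|t0 t1]; first by rewrite !mul0r /reset0 ltxx.
rewrite /reset0 pmulr_rgt0//; case: ifPn => [u0|_]; last by rewrite mulr0.
exact: N_function_le_scale.
Qed.

Lemma reset0_nondecreasing : {homo reset0 M : u v / u <= v}.
Proof.
move=> u v uv; case: (leP u 0) => [u0|u0].
  by rewrite {1}/reset0 ltNge u0/= reset0_ge0.
have v0 := lt_le_trans u0 uv.
have -> : u = u / v * v by rewrite divfK// gt_eqF.
apply: (le_trans (reset0_le_scale _ _ _)).
- by rewrite divr_ge0// ltW.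
- by rewrite ler_pdivrMr// mul1r.
by rewrite ler_piMl ?reset0_ge0// ler_pdivrMr// mul1r.
Qed.

Lemma measurable_reset0 : measurable_fun setT (reset0 M).
Proof. exact: nondecreasing_measurable reset0_nondecreasing. Qed.

(** Lets [lower_multiplier_le] carry strict positivity of M down to every
u > 0. *)
Lemma N_function_gt0_at_infinity u : exists2 v, u < v & 0 < M v.
Proof.
have Moo : \forall v \near pinfty_nbhs R, 0 < M v / v.
  exact: (cvgryPgt _).1 (N_function_cvgy MN) 0.
near (pinfty_nbhs R) => v.
have v0 : 0 < v by near: v; apply: nbhs_pinfty_gt; exact: num_real.
exists v; first by near: v; apply: nbhs_pinfty_gt; exact: num_real.
have : 0 < M v / v by near: v.
by rewrite pmulr_lgt0// invr_gt0.
Unshelve. all: by end_near. Qed.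

(** Convexity gives M (l * u) <= l * M u, so a lower multiplier cannot exceed l
once M u > 0; this positivity is itself inherited, through the multiplier
inequality, from a point v > u with M v > 0. *)
Lemma lower_multiplier_le (phi : R -> R -> R)
    (phi_gt0 : forall l u, 0 < l < 1 -> 0 < u -> 0 < phi l u)
    (phiM : forall l u, 0 < l < 1 -> 0 < u -> phi l u * M u <= M (l * u))
    l u : 0 < l < 1 -> 0 < u -> phi l u <= l.
Proof.
move=> l01 u0; have /andP[l0 l1] := l01.
have Mu0 : 0 < M u.
  have [v uv Mv0] := N_function_gt0_at_infinity u.
  have v0 := lt_trans u0 uv.
  have uv01 : 0 < u / v < 1 by rewrite divr_gt0// ltr_pdivrMr// mul1r.
  have := phiM _ _ uv01 v0; rewrite divfK ?gt_eqF//; apply: lt_le_trans.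
  exact: mulr_gt0 (phi_gt0 _ _ uv01 v0) Mv0.
rewrite -(ler_pM2r Mu0); apply: (le_trans (phiM _ _ l01 u0)).
exact: N_function_le_scale (ltW l1) u0.
Qed.

(** The two terms on the right bound the left side for v >= r and for v < r
respectively.  The case r = h * N, v = |x w| is the one that is integrated. *)
Lemma reset0_tradeoff f h p l b r v :
  0 <= f -> 0 < h -> 0 < p -> p <= l -> 0 < b -> h * p <= r -> r * b <= l ->
  (forall u, h <= u -> f * M u <= M (p * u)) ->
  l * f * reset0 M (v / l) <= p * reset0 M v + f * (r * b) * M b^-1.
Proof.
move=> f0 h0 p0 pl b0 hpr rbl fM.
have l0 : 0 < l := lt_le_trans p0 pl.
have r0 : 0 < r by apply: lt_le_trans hpr; exact: mulr_gt0.
have Mb0 : 0 <= M b^-1 by apply: (N_function_ge0 MN); rewrite invr_ge0 ltW.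
have rbM0 : 0 <= f * (r * b) * M b^-1.
  by rewrite mulr_ge0// mulr_ge0// mulr_ge0// ltW.
have pMv0 : 0 <= p * reset0 M v by rewrite mulr_ge0 ?reset0_ge0// ltW.
have [rv|vr] := leP r v.
  have v0 := lt_le_trans r0 rv.
  apply: (@le_trans _ _ (p * reset0 M v)); last by rewrite lerDl.
  have -> : v / l = p / l * (v / p) by field; rewrite !gt_eqF.
  have pl0 : 0 <= p / l by rewrite divr_ge0// ltW.
  have pl1 : p / l <= 1 by rewrite ler_pdivrMr// mul1r.
  have lf0 : 0 <= l * f by rewrite mulr_ge0// ltW.
  apply: (le_trans (ler_wpM2l lf0 (reset0_le_scale (v / p) pl0 pl1))).
  have -> : l * f * (p / l * reset0 M (v / p)) = p * (f * reset0 M (v / p)).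
    by field; rewrite gt_eqF.
  rewrite ler_pM2l// /reset0 divr_gt0// v0.
  have hvp : h <= v / p by rewrite ler_pdivlMr// (le_trans hpr).
  by have := fM _ hvp; rewrite [p * _]mulrC divfK ?gt_eqF.
apply: (@le_trans _ _ (f * (r * b) * M b^-1)); last by rewrite lerDr.
have [v0|v0] := leP v 0.
  by rewrite /reset0 pmulr_lgt0 ?invr_gt0// ltNge v0/= mulr0.
have -> : v / l = v * b / l * b^-1 by field; rewrite !gt_eqF.
have vb0 : 0 <= v * b / l by rewrite divr_ge0// ?mulr_ge0// ltW.
have vbr : v * b <= r * b by rewrite ler_pM2r// ltW.
have vb1 : v * b / l <= 1 by rewrite ler_pdivrMr// mul1r (le_trans vbr).
have lf0 : 0 <= l * f by rewrite mulr_ge0// ltW.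
apply: (le_trans (ler_wpM2l lf0 (reset0_le_scale b^-1 vb0 vb1))).
rewrite /reset0 invr_gt0 b0.
have -> : l * f * (v * b / l * M b^-1) = f * (v * b) * M b^-1.
  by field; rewrite gt_eqF.
by rewrite ler_wpM2r// ler_wpM2l.
Qed.

End N_function_theory.

(** * The modular and the Luxemburg norm *)

Section modular_theory.
Context {R : realType} (M : R -> R) (MN : N_function M).
Context {d : measure_display} {T : measurableType d}.
Variable mu : {measure set T -> \bar R}.

Lemma measurable_reset0_norm (x : T -> R) (l : R) : measurable_fun setT x ->
  measurable_fun setT (fun w => (reset0 M (`|x w| / l))%:E).
Proof.
move=> mx; apply/measurable_EFinP.
apply: (measurableT_comp (measurable_reset0 MN)).
apply: measurable_funM => //; exact: measurableT_comp.
Qed.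

(** The zero set of x / l is that of x, so its contribution does not depend on
l. *)
Lemma modular_reset0 (x : T -> R) (l : R) : 0 < l -> measurable_fun setT x ->
  modular mu M (fun w => x w / l) =
  (\int[mu]_w (reset0 M (`|x w| / l))%:E +
   (M 0)%:E * mu (x @^-1` [set 0%R]))%E.
Proof.
move=> l0 mx.
have M00 : 0 <= M 0 by exact: (N_function_ge0 MN).
have mZ : measurable (x @^-1` [set 0]).
  by rewrite -[X in measurable X]setTI; exact: mx.
have mI : measurable_fun setT (fun w => (\1_(x @^-1` [set 0]) w)%:E : \bar R).
  exact/measurable_EFinP.
rewrite -[in RHS](setIT (x @^-1` [set 0])) -integral_indic//.
rewrite -ge0_integralZl//.
rewrite -ge0_integralD//.
- apply: eq_integral => w _.
  rewrite normrM normfV (gtr0_norm l0) -EFinM -EFinD indicE; congr (_%:E).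
  have [xw0|xw0] := eqVneq (x w) 0.
    by rewrite mem_set// xw0 normr0 mul0r /reset0 ltxx add0r mulr1.
  rewrite memNset; last by apply/eqP.
  by rewrite mulr0 addr0 /reset0 divr_gt0// normr_gt0.
- by move=> w _; rewrite lee_fin reset0_ge0.
- exact: measurable_reset0_norm.
- by move=> w _; rewrite -EFinM lee_fin mulr_ge0.
- exact: measurable_funeM.
Qed.

Lemma modular_gt1 (x : T -> R) l : 0 < l -> l < luxemburg_norm mu M x ->
  (1 < modular mu M (fun w => x w / l)%R)%E.
Proof.
move=> l0; rewrite ltNge => /negP lN; rewrite ltNge; apply/negP => Ml.
by apply: lN; apply: ge_inf => //; exists 0 => y [/ltW].
Qed.

Lemma luxemburg_norm_ge0 (x : T -> R) : 0 <= luxemburg_norm mu M x.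
Proof.
rewrite /luxemburg_norm; set S := (X in inf X).
have [S0|/set0P/negP] := pselect (S !=set0).
  by apply: lb_le_inf => // y [/ltW].
by rewrite negbK => /eqP ->; rewrite inf0.
Qed.

Lemma luxemburg_norm_adherent (x : T -> R) e : 0 < e ->
  0 < luxemburg_norm mu M x ->
  exists b, [/\ 0 < b, (modular mu M (fun w => x w / b)%R <= 1)%E &
    b < luxemburg_norm mu M x + e].
Proof.
move=> e0 N0; rewrite /luxemburg_norm in N0 *; set S := (X in inf X) in N0 *.
have [] := @inf_adherent _ S _ e0.
  by apply: contrapT => /inf_out Si; rewrite Si ltxx in N0.
by move=> b [b0 Mb] bN; exists b.
Qed.

(** The hypothesis on b says that the integral of M (1 / b) over the space is at
most 1, which absorbs the factor M b^-1 of [reset0_tradeoff]. *)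
Lemma integral_tradeoff (x : T -> R) f h p l b r : measurable_fun setT x ->
  0 <= f -> 0 < h -> 0 < p -> p <= l -> 0 < b -> h * p <= r -> r * b <= l ->
  (forall u, h <= u -> f * M u <= M (p * u)) ->
  (modular mu M (fun=> 1 / b)%R <= 1)%E ->
  ((l * f)%:E * \int[mu]_w (reset0 M (`|x w| / l))%:E <=
   p%:E * \int[mu]_w (reset0 M `|x w|)%:E + (f * (r * b))%:E)%E.
Proof.
move=> mx f0 h0 p0 pl b0 hpr rbl fM Mb1.
have l0 : 0 < l := lt_le_trans p0 pl.
have r0 : 0 < r by apply: lt_le_trans hpr; exact: mulr_gt0.
have Mb0 : 0 <= M b^-1 by apply: (N_function_ge0 MN); rewrite invr_ge0 ltW.
have frb0 : 0 <= f * (r * b) by rewrite mulr_ge0// mulr_ge0// ltW.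
have lf0 : 0 <= l * f by rewrite mulr_ge0// ltW.
have mJl := measurable_reset0_norm l mx.
have mJ : measurable_fun setT (fun w => (reset0 M `|x w|)%:E).
  by under eq_fun do rewrite -[`|_|]divr1; exact: measurable_reset0_norm.
have : ((f * (r * b))%:E * \int[mu]_w (M b^-1)%:E <= (f * (r * b))%:E)%E.
  rewrite -[leRHS]mule1; apply: lee_wpmul2l; first by rewrite lee_fin.
  apply: le_trans Mb1; rewrite /modular.
  by under [leRHS]eq_integral do rewrite div1r gtr0_norm ?invr_gt0//.
have R0 u : (0 <= (reset0 M u)%:E)%E by rewrite lee_fin reset0_ge0.
have p0' := ltW p0.
rewrite -!ge0_integralZl//.
move=> frb; apply: le_trans (leeD2l _ frb); rewrite -ge0_integralD//.
- apply: ge0_le_integral => //.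
  + by move=> w _; rewrite -EFinM lee_fin mulr_ge0// reset0_ge0.
  + exact: measurable_funeM.
  + apply: emeasurable_funD; first exact: measurable_funeM.
    exact: measurable_cst.
  + move=> w _; rewrite -!EFinM -EFinD lee_fin.
    exact: (reset0_tradeoff MN _ f0 h0 p0 pl b0 hpr rbl fM).
- by move=> w _; rewrite -EFinM lee_fin mulr_ge0 ?reset0_ge0// ltW.
- exact: measurable_funeM.
- by move=> w _; rewrite -EFinM lee_fin mulr_ge0.
Qed.

End modular_theory.

(** * The lower bound of the modular *)

Theorem theorem4 (R : realType) (d : measure_display) (T : measurableType d)
    (mu : {measure set T -> \bar R}) (mu_fin : (mu setT < +oo)%E)
    (mu_cont : continuous_measure mu)
    (M : R -> R) (MN : N_function M)
    (phi : R -> R -> R)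
    (phi_gt0 : forall l u, 0 < l < 1 -> 0 < u -> 0 < phi l u)
    (phi_nd1 : forall l1 l2 u, 0 < l1 -> l1 <= l2 -> l2 < 1 -> 0 < u ->
       phi l1 u <= phi l2 u)
    (phi_nd2 : forall l u1 u2, 0 < l < 1 -> 0 < u1 -> u1 <= u2 ->
       phi l u1 <= phi l u2)
    (phiM : forall l u, 0 < l < 1 -> 0 < u -> phi l u * M u <= M (l * u))
    (x : T -> R) (xL : orlicz_space mu M x)
    (x_neq0 : luxemburg_norm mu M x != 0) (x_le1 : luxemburg_norm mu M x <= 1)
    (h : R) (h_gt0 : 0 < h) (h_lt : h < (luxemburg_norm mu M (cst 1))^-1) :
  ((phi ((1 - h * luxemburg_norm mu M (cst 1)) * luxemburg_norm mu M x) h)%:E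
     <= modular mu M x)%E.
Proof.
have [mx _] := xL.
set a := luxemburg_norm mu M (cst 1) in h_lt *.
set N := luxemburg_norm mu M x in x_neq0 x_le1 *.
have N0 : 0 < N by rewrite lt_neqAle eq_sym x_neq0 luxemburg_norm_ge0.
have a0 : 0 < a by rewrite -invr_gt0 (lt_trans h_gt0).
have ha1 : h * a < 1 by rewrite -ltr_pdivlMr// div1r.
have ha0 : 0 < h * a by exact: mulr_gt0.
set c := 1 - h * a.
have c0 : 0 < c by rewrite subr_gt0.
have c1 : c < 1 by rewrite /c; lra.
set p := c * N.
have p0 : 0 < p by exact: mulr_gt0.
have p1 : p < 1 by rewrite (le_lt_trans _ c1)// ler_piMr// ltW.
have p01 : 0 < p < 1 by rewrite p0.
set f := phi p h.
have f0 : 0 < f by exact: phi_gt0.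
have fc : f <= c.
  apply: (le_trans (lower_multiplier_le MN phi_gt0 phiM p01 h_gt0)).
  by rewrite ler_piMr// ltW.
have fM u : h <= u -> f * M u <= M (p * u).
  move=> hu; have u0 := lt_le_trans h_gt0 hu.
  apply: (le_trans _ (phiM _ _ p01 u0)); apply: ler_wpM2r.
    exact: N_function_ge0 MN _ (ltW u0).
  exact: phi_nd2.
have M00 : 0 <= M 0 by exact: (N_function_ge0 MN).
have mZ : measurable (x @^-1` [set 0]).
  by rewrite -[X in measurable X]setTI; exact: mx.
have Zfin : mu (x @^-1` [set 0]) \is a fin_num.
  by rewrite ge0_fin_numE// (le_lt_trans _ mu_fin)// le_measure// inE.
have [k k0 kE] : exists2 k, 0 <= k &
    ((M 0)%:E * mu (x @^-1` [set 0%R]) = k%:E)%E.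
  exists (M 0 * fine (mu (x @^-1` [set 0]))); last by rewrite EFinM fineK.
  by rewrite mulr_ge0// fine_ge0.
have modE := modular_reset0 MN mu ltr01 mx.
have x1 : (fun w => x w / 1) = x by apply/funext => w; rewrite divr1.
rewrite x1 kE in modE; rewrite modE.
under eq_integral do rewrite divr1.
have : (0 <= \int[mu]_w (reset0 M `|x w|)%:E)%E.
  by apply: integral_ge0 => w _; rewrite lee_fin reset0_ge0.
(* The term J is kept as an extended real here; the theorem is immediate when
   it is infinite. *)
have : forall l b, p <= l -> l < N -> 0 < b ->
    (modular mu M (fun=> 1 / b)%R <= 1)%E -> h * N * b <= l ->
    ((l * f * (1 - k))%:E <=
      p%:E * \int[mu]_w (reset0 M `|x w|)%:E + (f * (h * N * b))%:E)%E.
  move=> l b pl lN b0 Mb rbl; have l0 := lt_le_trans p0 pl.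
  apply: le_trans (integral_tradeoff MN mx (ltW f0) h_gt0 p0 pl b0 _ rbl fM Mb).
    rewrite EFinM; apply: lee_wpmul2l; first by rewrite lee_fin mulr_ge0// ltW.
    have := modular_gt1 l0 lN; rewrite (modular_reset0 MN mu l0 mx) kE.
    by rewrite EFinB leeBlDr// => /ltW.
  by rewrite ler_pM2l// /p ler_piMl// ltW.
move: (\int[mu]_w _)%E => [J| |] //; last by move=> _ _; rewrite addye// leey.
move=> tradeoff J0; rewrite -EFinD lee_fin; rewrite lee_fin in J0.
have limit : f * (1 - k) <= c * J + f * (h * a).
  rewrite leNgt; apply/negP => gap.
  set g := f * (1 - k) - (c * J + f * (h * a)).
  have g0 : 0 < g by rewrite subr_gt0.
  (* The three bounds on e ensure p <= N * (1 - e), h * N * b <= N * (1 - e) for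
     b < a + e, and a total error e * f * (1 + h) of at most g / 2. *)
  pose e := Num.min (h * a) (Num.min (c / (1 + h)) (g / (2 * (f * (1 + h))))).
  have h1 : 0 < 1 + h by lra.
  have fh0 : 0 < f * (1 + h) by exact: mulr_gt0.
  have e0 : 0 < e.
    by rewrite !lt_min ha0 !divr_gt0// mulr_gt0.
  have : e <= e by [].
  rewrite {2}/e !le_min => /and3P[eha]; rewrite !ler_pdivlMr ?mulr_gt0//.
  move=> ec eg.
  have [b [b0 Mb bN]] := luxemburg_norm_adherent e0 a0.
  have lN : N * (1 - e) < N by nra.
  have hb : h * b <= h * (a + e) by rewrite ler_pM2l// ltW.
  have pl : p <= N * (1 - e).
    by rewrite /p mulrC ler_pM2l// /c lerD2l lerN2.
  have rbl : h * N * b <= N * (1 - e).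
    rewrite mulrAC mulrC ler_pM2l// (le_trans hb)//.
    by move: ec; rewrite /c; lra.
  have := tradeoff _ _ pl lN b0 Mb rbl; rewrite -EFinM -EFinD lee_fin.
  have -> : N * (1 - e) * f * (1 - k) = N * (f * (1 - k) - e * (f * (1 - k))).
    by ring.
  have -> : p * J + f * (h * N * b) = N * (c * J + f * (h * b)).
    by rewrite /p; ring.
  rewrite ler_pM2l// => key.
  have fhb : f * (h * b) <= f * (h * (a + e)) by rewrite ler_pM2l.
  have efk : 0 <= e * (f * k) by rewrite !mulr_ge0// ltW.
  have : g <= g / 2 by rewrite /g; move: eg; rewrite /g; nra.
  by rewrite leNgt => /negP; apply; lra.
have fk : f * k <= c * k by rewrite ler_wpM2r.
rewrite -(ler_pM2l c0) mulrDr; move: limit fk; rewrite /c; lra.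
Qed.
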